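(* If $P\subset\mathbb{R}^2$ is a quasi-smooth lattice polygon with the origin in its interior, then $\mathcal{E}(P)$ contains a lattice basis, i.e. a $\mathbb{Z}$-basis of $\mathbb{Z}^2$.
   Context: $\mathcal{E}(P):=\mathbb{Z}^2\cap P\cap(-P)$. A vertex $v$ of a lattice polygon $P$ is quasi-smooth if it lies at lattice distance one from the line through $v^+$ and $v^-$, where $v^+$ and $v^-$ are the lattice points immediately previous and next to $v$ along the boundary $\partial P$. The polygon $P$ is quasi-smooth if all its vertices are. The lattice distance from a point $x_0$ to a line $\{x:u\cdot x=b\}$ with $u\in\mathbb{Z}^2$ primitive is $|b-u\cdot x_0|$. *)

(* Defs.v *)
From HB Require Import structures.
From mathcomp Require Import all_boot all_order all_algebra.
From mathcomp Require Import all_classical all_reals all_analysis.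

Set Implicit Arguments.
Unset Strict Implicit.
Unset Printing Implicit Defensive.

Import Order.TTheory GRing.Theory Num.Theory.
Import numFieldNormedType.Exports.

Local Open Scope classical_set_scope.
Local Open Scope ring_scope.

Section LatticePolygons.
Variable R : realType.
Local Notation plane := 'rV[R]_2.
Implicit Types (P : set plane) (u : 'rV[int]_2) (v w x y : plane).

Definition lattice : set plane := [set x | x \is a mxOver Num.int].

Definition lattice_basis (e1 e2 : plane) : Prop :=
  [/\ lattice e1, lattice e2 &
      forall z, lattice z ->
        exists! mn : int * int, z = e1 *~ mn.1 + e2 *~ mn.2].

Definition convex_hull (V : set plane) : set plane :=
  smallest (@convex_set R plane) V.

(* Polygons are two-dimensional, hence the nonempty interior. *)
Definition lattice_polygon P : Prop :=
  (exists V : set plane,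
     [/\ finite_set V, V `<=` lattice & P = convex_hull V]) /\
  interior P !=set0.

Definition boundary P : set plane := closure P `\` interior P.

Definition segment x y : set plane :=
  [set (1 - t) *: x + t *: y | t in `[0, 1]].

Definition line_through x y : set plane :=
  [set x + t *: (y - x) | t in [set: R]].

(* The vertices of a polygon are its extreme points. *)
Definition vertex P v : Prop :=
  P v /\ forall x y, P x -> P y ->
    forall t : R, 0 < t < 1 -> v = (1 - t) *: x + t *: y -> x = v /\ y = v.

Definition det2 x y : R := x 0 0 * y 0 1 - x 0 1 * y 0 0.

(* [next_along P v w]: the lattice point w comes immediately after the lattice
   point v on the boundary of P, traversed counterclockwise. The boundary of a
   lattice polygon turns only at lattice points, so the arc from v to w is a
   segment; the determinant condition says that P lies on the left of the ray
   from v to w. *)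
Definition next_along P v w : Prop :=
  [/\ v <> w,
      segment v w `<=` boundary P,
      segment v w `&` lattice = [set v; w] &
      forall x, P x -> 0 <= det2 (w - v) (x - v)].

Definition primitive u : Prop := coprimez (u 0 0) (u 0 1).

Definition dot u x : R := \sum_i (u 0 i)%:~R * x 0 i.

Definition has_lattice_dist x (L : set plane) (d : R) : Prop :=
  exists u (b : R),
    [/\ primitive u, L = [set y | dot u y = b] & `|b - dot u x| = d].

Definition quasi_smooth_vertex P v : Prop :=
  exists vm vp, [/\ next_along P vm v, next_along P v vp &
                    has_lattice_dist v (line_through vm vp) 1].

Definition quasi_smooth P : Prop :=
  forall v, vertex P v -> quasi_smooth_vertex P v.

Definition calE P : set plane := lattice `&` P `&` (-%R @` P).

End LatticePolygons.

(* Main.v *)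
Require Import Defs.
From mathcomp Require Import all_boot all_order all_algebra.
From mathcomp Require Import zify ring lra.
From mathcomp Require Import all_classical all_reals all_analysis.
Import numFieldNormedType.Exports.

(** Let L be the set of lattice points of P. The theorem is proved for L, in
    integer coordinates, from a few properties gathered in the record eared: L
    is closed under taking lattice points of convex hulls, bounded, spreads
    around the origin in all directions, and has an ear at each vertex. The
    ear at v is the triangle v-, v, v+ formed with the neighbours of v. Their
    line is at lattice distance one from v, and the origin, being an interior
    lattice point, lies on this line or beyond it (ear_of_neighbours); so the
    origin is never inside an ear.

    The key fact (eared_right) is that when (1, 0) is in L, the rightmost points
    (B, 1) and (D, -1) of L at heights 1 and -1 satisfy B + D >= 0. Otherwise
    the boundary of P would bend so sharply at height 0 that the ear at the
    rightmost point of this height would contain the origin.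
    By symmetry, when (-1, 0) is in L, the leftmost points (A, 1) and (C, -1)
    satisfy A + C <= 0. When both inequalities hold, the integer intervals
    [A, B] and [-D, -C] overlap, and L contains (x, 1) and (-x, -1) for some x.
    Hence, if L contains a primitive vector f and its opposite, then
    it contains a second pair of opposite points completing f to a
    lattice basis (eared_opposite_basis).

    It remains to find f. Take a lattice basis e, e' in L that is as obtuse as
    possible, so that e - e' and e' - e are not in L. As the origin is interior,
    L has a point with negative coordinate sum in this basis. Elementary
    convexity then shows that L contains - e, - e' or - (e + e')
    (eared_obtuse_basis). In the first two cases f is found. In the last one
    the inequality A + C <= 0 is witnessed by e' and - (e + e'), so the key
    fact alone gives an overlap of the two intervals, hence a vector f.

    The passage from P to L uses that P, the hull of a finite set, is compact
    (convex_hull_compact), and that a unique maximizer of a linear functional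
    on the generators of P is a vertex of P. *)

Set Implicit Arguments.
Unset Strict Implicit.
Unset Printing Implicit Defensive.
Import Order.TTheory GRing.Theory Num.Theory.

Local Open Scope classical_set_scope.
Local Open Scope ring_scope.

(** * Integer sets with ears *)

Lemma int_has_max (S : int -> Prop) (N : int) :
  (exists k, S k) -> (forall k, S k -> k <= N) ->
  exists2 M, S M & forall k, S k -> k <= M.
Proof.
move=> [k0 Sk0] ubN.
have ex : exists n : nat, `[<S (N - n%:Z)>].
  exists `|N - k0|%N; apply/asboolP.
  by rewrite gez0_abs ?subr_ge0 ?ubN // subKr.
case: (ex_minnP ex) => n /asboolP Sn n_min.
exists (N - n%:Z) => // k Sk; have kN := ubN k Sk.
have /n_min : `[<S (N - `|N - k|%N%:Z)>].
  by apply/asboolP; rewrite gez0_abs ?subr_ge0 // subKr.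
by lia.
Qed.

(** The certificate extracted from quasi-smoothness: lattice points p and q of L
    on the two sides of the line from the origin to v, together with an
    integer functional (m, n) that takes equal values at p and q, just one
    below its value at v. The positivity of the value at v says that the
    origin does not lie in the triangle v, p, q, except perhaps on the side
    p q. *)
Definition has_ear (L : int -> int -> Prop) (vx vy : int) : Prop :=
  exists px py qx qy m n : int,
    [/\ L px py /\ L qx qy, 1 <= m * vx + n * vy,
        m * px + n * py = m * vx + n * vy - 1 /\
        m * qx + n * qy = m * vx + n * vy - 1,
        0 < vx * py - vy * px & vx * qy - vy * qx < 0].

(** What the argument uses of the lattice points of a quasi-smooth polygon with
    the origin in its interior. Every clause is expressed by means of arbitrary
    integer functionals or of convex combinations with integer weights, so
    that it survives a change of lattice basis (eared_change). Vertices appear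
    only as unique maximizers of integer functionals. *)
Record eared (L : int -> int -> Prop) : Prop := Eared {
  eared_conv : forall x1 y1 x2 y2 x3 y3 n1 n2 n3 x y : int,
    L x1 y1 -> L x2 y2 -> L x3 y3 ->
    0 <= n1 -> 0 <= n2 -> 0 <= n3 -> 0 < n1 + n2 + n3 ->
    (n1 + n2 + n3) * x = n1 * x1 + n2 * x2 + n3 * x3 ->
    (n1 + n2 + n3) * y = n1 * y1 + n2 * y2 + n3 * y3 -> L x y;
  eared_bounded : forall g h : int, exists N : int,
    forall x y, L x y -> g * x + h * y <= N;
  eared_origin : L 0 0;
  eared_around : forall g h : int, (g, h) <> (0, 0) ->
    exists x y, L x y /\ 0 < g * x + h * y;
  eared_ear : forall vx vy g h : int, L vx vy ->
    (forall x y, L x y -> (x, y) <> (vx, vy) ->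
      g * x + h * y < g * vx + h * vy) ->
    has_ear L vx vy }.

(** Convexity, boundedness and the ears are notions of the lattice, not of its
    coordinates. Reflections are included: they exchange the two sides of an
    ear. *)
Lemma eared_change L (a b c d : int) :
  a * d - b * c = 1 \/ a * d - b * c = -1 ->
  eared L -> eared (fun x y => L (a * x + b * y) (c * x + d * y)).
Proof.
move eE : (a * d - b * c) => e e1 [cv bd L0 ar ear].
have ee : e * e = 1 by case: e1 => ->.
pose X1 X Y := e * (d * X - b * Y); pose Y1 X Y := e * (a * Y - c * X).
have inv1 X Y : a * X1 X Y + b * Y1 X Y = X.
  transitivity (e * (a * d - b * c) * X); first by rewrite /X1 /Y1; ring.
  by rewrite eE ee mul1r.
have inv2 X Y : c * X1 X Y + d * Y1 X Y = Y.
  transitivity (e * (a * d - b * c) * Y); first by rewrite /X1 /Y1; ring.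
  by rewrite eE ee mul1r.
have inv3 x y : X1 (a * x + b * y) (c * x + d * y) = x.
  transitivity (e * (a * d - b * c) * x); first by rewrite /X1; ring.
  by rewrite eE ee mul1r.
have inv4 x y : Y1 (a * x + b * y) (c * x + d * y) = y.
  transitivity (e * (a * d - b * c) * y); first by rewrite /Y1; ring.
  by rewrite eE ee mul1r.
pose g1 g h := e * (g * d - h * c); pose h1 g h := e * (h * a - g * b).
have pull g h X Y : g1 g h * X + h1 g h * Y = g * X1 X Y + h * Y1 X Y.
  by rewrite /g1 /h1 /X1 /Y1; ring.
have push m n X Y :
    (m * a + n * c) * X1 X Y + (m * b + n * d) * Y1 X Y = m * X + n * Y.
  transitivity (m * (a * X1 X Y + b * Y1 X Y) + n * (c * X1 X Y + d * Y1 X Y)).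
    by ring.
  by rewrite inv1 inv2.
split.
- move=> x1 y1 x2 y2 x3 y3 n1 n2 n3 x y L1 L2 L3 p1 p2 p3 p Ex Ey.
  apply: (cv _ _ _ _ _ _ n1 n2 n3 _ _ L1 L2 L3) => //.
    transitivity (a * ((n1 + n2 + n3) * x) + b * ((n1 + n2 + n3) * y)).
      by ring.
    by rewrite Ex Ey; ring.
  transitivity (c * ((n1 + n2 + n3) * x) + d * ((n1 + n2 + n3) * y)).
    by ring.
  by rewrite Ex Ey; ring.
- move=> g h; have [N bdN] := bd (g1 g h) (h1 g h); exists N => x y /bdN.
  by rewrite pull inv3 inv4.
- by rewrite !mulr0 addr0.
- move=> g h gh0.
  have [|X [Y [LXY pos]]] := ar (g1 g h) (h1 g h).
    case=> E1 E2; apply: gh0.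
    have gE : g = a * g1 g h + c * h1 g h.
      transitivity (e * (a * d - b * c) * g); first by rewrite eE ee mul1r.
      by rewrite /g1 /h1; ring.
    have hE : h = b * g1 g h + d * h1 g h.
      transitivity (e * (a * d - b * c) * h); first by rewrite eE ee mul1r.
      by rewrite /g1 /h1; ring.
    by congr (_, _); [rewrite gE|rewrite hE]; rewrite E1 E2 !mulr0.
  by exists (X1 X Y), (Y1 X Y); rewrite inv1 inv2 -pull.
- move=> vx vy g h Lv vmax.
  have [|px [py [qx [qy [m [n [[Lp Lq] u1 [up uq] dp dq]]]]]]] :=
    ear _ _ (g1 g h) (h1 g h) Lv.
    move=> X Y LXY neq; rewrite !pull inv3 inv4.
    apply: vmax; first by rewrite inv1 inv2.
    by case=> E1 E2; apply: neq; rewrite -E1 -E2 inv1 inv2.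
  have dete X Y : vx * Y1 X Y - vy * X1 X Y =
      e * ((a * vx + b * vy) * Y - (c * vx + d * vy) * X).
    by rewrite /X1 /Y1; ring.
  have linv : (m * a + n * c) * vx + (m * b + n * d) * vy =
      m * (a * vx + b * vy) + n * (c * vx + d * vy) by ring.
  case: e1 => e1.
    exists (X1 px py), (Y1 px py), (X1 qx qy), (Y1 qx qy),
      (m * a + n * c), (m * b + n * d).
    by rewrite !push linv !dete !inv1 !inv2 e1 !mul1r.
  (* an orientation-reversing change exchanges the two neighbours *)
  exists (X1 qx qy), (Y1 qx qy), (X1 px py), (Y1 px py),
      (m * a + n * c), (m * b + n * d).
  by rewrite !push linv !dete !inv1 !inv2 e1 !mulN1r oppr_gt0 oppr_lt0.
Qed.

(** * Points at heights one and minus one *)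

(** At height 1 the triangle (0, 0), (1, 0), (x, y) covers the abscissas from
    x / y to x / y + 1 - 1 / y. This interval contains the integer
    k = ceil (x / y). *)
Lemma eared_ceil L x y : eared L -> L 1 0 -> L x y -> 1 <= y ->
  exists2 k, L k 1 & x <= k * y.
Proof.
move=> eL L10 Lxy y1.
have y0 : y != 0 by lia.
pose k := - ((- x) %/ y)%Z; pose r := ((- x) %% y)%Z.
have xE : - x = - k * y + r by rewrite /k /r opprK; exact: divz_eq.
have r0 : 0 <= r by exact: modz_ge0.
have ry : r < y by rewrite ltz_pmod //; lia.
exists k; last by nia.
(* (k, 1) is the barycentre with weights 1 at (x, y) and r = k y - x at (1, 0),
   completed at the origin to the total weight y. *)
apply: (eared_conv eL Lxy L10 (eared_origin eL)
  (n1 := 1) (n2 := r) (n3 := y - 1 - r)); lia.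
Qed.


(** The rightmost point (B, 1) at height 1 bounds the upper part of L by the
    line through it and the origin, since by eared_ceil a point beyond this
    line would produce a point (k, 1) with B < k. *)
Lemma eared_top L : eared L -> L 1 0 ->
  exists2 B, L B 1 & forall x y, L x y -> 1 <= y -> x <= B * y.
Proof.
move=> eL L10.
have [x [y [Lxy ypos]]] := eared_around eL (g := 0) (h := 1) ltac:(by []).
have [|k0 Lk0 _] := eared_ceil eL L10 Lxy; first by lia.
have [N bdN] := eared_bounded eL 1 0.
have [||B LB Bmax] := int_has_max (S := fun k => L k 1) (N := N).
- by exists k0.
- by move=> k /bdN; lia.
exists B => // {Lxy ypos}x {}y Lxy y1.
have [k /Bmax kB xk] := eared_ceil eL L10 Lxy y1.
by nia.
Qed.

(** The heart of the proof, and the only place where an ear is exploited. Let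
    (B, 1) and (D, -1) be the rightmost points at heights 1 and -1. If B + D were
    negative, the functional x - B y would be nonpositive on L away from
    height 0, so that its maximum would be reached only at the rightmost point
    (q, 0) of height 0. The ear there gives p at height t > 0 and p' at height
    - t' < 0 with m p_x + n t = m q - 1 = m p'_x - n t'. Since p_x <= B t and
    p'_x <= D t', this forces 0 <= m q - 1 <= (m B + n) t and
    0 <= (m D - n) t', whence 0 <= m (B + D): a contradiction. *)
Lemma eared_right L : eared L -> L 1 0 ->
  exists B D, [/\ L B 1, L D (-1) & 0 <= B + D].
Proof.
move=> eL L10.
have [B LB Bmax] := eared_top eL L10.
have [D LD Dmax] : exists2 D, L D (-1) &
    forall x y, L x y -> y <= -1 -> x <= D * - y.
  have eL' : eared (fun x y => L (1 * x + 0 * y) (0 * x + -1 * y)).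
    by apply: eared_change => //; right.
  have flip x y : L (1 * x + 0 * y) (0 * x + -1 * y) = L x (- y).
    by congr L; ring.
  have [|D LD Dmax] := eared_top eL'; first by rewrite flip oppr0.
  exists D => [|x y Lxy y1]; first by rewrite -flip.
  by apply: Dmax; rewrite ?flip ?opprK //; lia.
exists B, D; split => //; rewrite leNgt; apply/negP => BD.
have [q Lq qmax] : exists2 q, L q 0 & forall x, L x 0 -> x <= q.
  have [N bdN] := eared_bounded eL 1 0.
  apply: (int_has_max (S := fun k => L k 0) (N := N)); first by exists 1.
  by move=> k /bdN; lia.
have q1 : 1 <= q := qmax _ L10.
have [|px [py [qx [qy [m [n [[Lp Lr] u1 [up uq] dp dq]]]]]]] :=
    eared_ear eL (vx := q) (vy := 0) (g := 1) (h := - B) Lq.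
  move=> x y Lxy neq.
  have [y0|y0|y0] := ltgtP y 0.
  - by have := Dmax _ _ Lxy ltac:(lia); nia.
  - by have := Bmax _ _ Lxy ltac:(lia); nia.
  - move: neq Lxy; rewrite y0 => neq /qmax xq.
    have : x <> q by move=> E; apply: neq; rewrite E.
    by lia.
have py1 : 1 <= py by nia.
have qy1 : qy <= -1 by nia.
have pB := Bmax _ _ Lp py1; have qD := Dmax _ _ Lr qy1.
have m1 : 1 <= m by nia.
have hB : 0 <= m * B + n.
  have : m * px <= m * (B * py) by rewrite ler_wpM2l //; lia.
  by nia.
have hD : 0 <= m * D - n.
  have : m * qx <= m * (D * - qy) by rewrite ler_wpM2l //; lia.
  by nia.
by nia.
Qed.

Lemma eared_left L : eared L -> L (-1) 0 ->
  exists A C, [/\ L A 1, L C (-1) & A + C <= 0].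
Proof.
move=> eL L10.
have eL' : eared (fun x y => L (-1 * x + 0 * y) (0 * x + 1 * y)).
  by apply: eared_change => //; right.
have flip x y : L (-1 * x + 0 * y) (0 * x + 1 * y) = L (- x) y.
  by congr L; ring.
have [|B [D []]] := eared_right eL'; first by rewrite flip.
rewrite !flip => LB LD BD; exists (- B), (- D); split => //; lia.
Qed.

Lemma eared_level L y a b x : eared L -> L a y -> L b y -> a <= x <= b -> L x y.
Proof.
move=> eL La Lb /andP[ax xb].
have [<- //|ab] := eqVneq a x.
by apply: (eared_conv eL La Lb La (n1 := b - x) (n2 := x - a) (n3 := 0));
  [lia|lia|lia|lia|ring|ring].
Qed.

(** Heights 1 and -1 meet L in integer intervals. The hypotheses say that the
    first interval and the opposite of the second one overlap. *)
Lemma eared_strip L A B C D : eared L ->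
  L A 1 -> L B 1 -> L C (-1) -> L D (-1) ->
  0 <= B + D -> A + C <= 0 -> exists x, L x 1 /\ L (- x) (-1).
Proof.
move=> eL LA LB LC LD BD AC.
have [le|lt] := leP (- D) A.
  exists A; split => //; apply: (eared_level eL LC LD); lia.
exists (- D); split; first by apply: (eared_level eL LA LB); lia.
by rewrite opprK.
Qed.

Lemma eared_opposite L : eared L -> L 1 0 -> L (-1) 0 ->
  exists x, L x 1 /\ L (- x) (-1).
Proof.
move=> eL L10 LN10.
have [B [D [LB LD BD]]] := eared_right eL L10.
have [A [C [LA LC AC]]] := eared_left eL LN10.
exact: (eared_strip eL LA LB LC LD).
Qed.

(** Here the left-hand inequality needed by eared_strip is witnessed by (0, 1)
    and (-1, -1). *)
Lemma eared_triple L : eared L -> L 1 0 -> L 0 1 -> L (-1) (-1) ->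
  exists x, L x 1 /\ L (- x) (-1).
Proof.
move=> eL L10 L01 LN.
have [B [D [LB LD BD]]] := eared_right eL L10.
exact: (eared_strip eL L01 LB LN LD).
Qed.

(** * Existence of an opposite basis *)

Definition has_opposite_basis (L : int -> int -> Prop) : Prop :=
  exists a b c d : int, [/\ a * d - b * c = 1,
    L a c /\ L (- a) (- c) & L b d /\ L (- b) (- d)].

Lemma has_opposite_basis_change L (a b c d : int) : a * d - b * c = 1 ->
  has_opposite_basis (fun x y => L (a * x + b * y) (c * x + d * y)) ->
  has_opposite_basis L.
Proof.
move=> det1 [p [q [r [s [det2 [Lp LNp] [Lq LNq]]]]]].
exists (a * p + b * r), (a * q + b * s), (c * p + d * r), (c * q + d * s).
split.
- transitivity ((a * d - b * c) * (p * s - q * r)); first by ring.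
  by rewrite det1 det2.
- by split=> //; move: LNp; congr L; ring.
- by split=> //; move: LNq; congr L; ring.
Qed.

(** In coordinates where the primitive vector f = (a, c) is (1, 0), the point
    found by eared_opposite has height 1, so that it completes f to a
    basis. *)
Lemma eared_opposite_basis L a c u v : eared L -> u * a + v * c = 1 ->
  L a c -> L (- a) (- c) -> has_opposite_basis L.
Proof.
move=> eL bez La LNa.
have det1 : a * u - - v * c = 1 by rewrite -bez; ring.
apply: (has_opposite_basis_change det1).
have [||x [Lx LNx]] := eared_opposite (eared_change (or_introl det1) eL).
- by move: La; congr L; ring.
- by move: LNa; congr L; ring.
exists 1, x, 0, 1; split; first by ring.
  split; first by move: La; congr L; ring.
  by move: LNa; congr L; ring.
by [].
Qed.

Lemma eared_unimodular_pair L : eared L ->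
  exists a b c d, [/\ a * d - b * c = 1, L a c & L b d].
Proof.
move=> eL.
have [x [y [Lxy xpos]]] := eared_around eL (g := 1) (h := 0) ltac:(by []).
have [u [v bez]] := Bezoutz x y.
move: bez; move gE : (gcdz x y) => g bez.
have g1 : 1 <= g.
  have : g != 0 by rewrite -gE gcdz_eq0; apply/negP => /andP[/eqP x0 _]; lia.
  have : 0 <= g by rewrite -gE.
  by lia.
have [a xE] : exists a, x = a * g.
  by apply/dvdzP; rewrite -gE; exact: dvdz_gcdl.
have [c yE] : exists c, y = c * g.
  by apply/dvdzP; rewrite -gE; exact: dvdz_gcdr.
have La : L a c.
  have L0 := eared_origin eL.
  apply: (eared_conv eL Lxy L0 L0 (n1 := 1) (n2 := g - 1) (n3 := 0));
    rewrite ?xE ?yE; lia.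
have det1 : a * u - - v * c = 1.
  apply: (mulIf (x := g)); first by lia.
  by rewrite mul1r -[RHS]bez [in RHS]xE [in RHS]yE; ring.
have eL' := eared_change (or_introl det1) eL.
have L10 : L (a * 1 + - v * 0) (c * 1 + u * 0) by move: La; congr L; ring.
have [k Lk _] := eared_top eL' L10.
exists a, (a * k + - v * 1), c, (c * k + u * 1); split => //.
by rewrite -[RHS]det1; ring.
Qed.

(** Among the lattice bases formed by two points of L, choose one whose scalar
    product is the least, which exists by boundedness. Replacing a vector of
    the basis by the difference of both would decrease the scalar product, so
    these differences are not in L. *)
Lemma eared_obtuse_pair L : eared L ->
  exists a b c d, [/\ a * d - b * c = 1, L a c & L b d] /\
    ~ L (a - b) (c - d) /\ ~ L (b - a) (d - c).
Proof.
move=> eL.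
pose S k := exists a b c d,
  [/\ a * d - b * c = 1, L a c & L b d] /\ k = - (a * b + c * d).
have [N bdN] : exists N : int, forall x y, L x y -> `|x| <= N /\ `|y| <= N.
  have [N1 b1] := eared_bounded eL 1 0; have [N2 b2] := eared_bounded eL (-1) 0.
  have [N3 b3] := eared_bounded eL 0 1; have [N4 b4] := eared_bounded eL 0 (-1).
  exists (`|N1| + `|N2| + `|N3| + `|N4|) => x y Lxy.
  by have := b1 _ _ Lxy; have := b2 _ _ Lxy; have := b3 _ _ Lxy;
    have := b4 _ _ Lxy; lia.
have [||_ [a [b [c [d [[det1 La Lb] ->]]]]] Smax] :=
    @int_has_max S (N * N + N * N).
- have [a [b [c [d pr]]]] := eared_unimodular_pair eL.
  by exists (- (a * b + c * d)), a, b, c, d.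
- move=> _ [a [b [c [d [[_ /bdN[ha hc] /bdN[hb hd]] ->]]]]].
  by rewrite (le_trans (ler_norm _)) // normrN (le_trans (ler_normD _ _)) //
    !normrM lerD // ler_pM.
have sq_pos (p q : int) : p <> 0 \/ q <> 0 -> 0 < p * p + q * q.
  have := sqr_ge0 p; have := sqr_ge0 q; rewrite !expr2 => q2 p2.
  by case=> [/eqP|/eqP] nz;
    [have : p * p != 0|have : q * q != 0]; rewrite ?mulf_neq0 //; lia.
exists a, b, c, d; split => //; split => LN.
  have pos : 0 < b * b + d * d.
    apply: sq_pos; case: (eqVneq b 0) => [b0|/eqP]; last by left.
    by right=> d0; move: det1; rewrite b0 d0; lia.
  have : - ((a - b) * b + (c - d) * d) <= - (a * b + c * d).
    by apply: Smax; exists (a - b), b, (c - d), d; split => //; split => //;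
      rewrite -[RHS]det1; ring.
  by lia.
have pos : 0 < a * a + c * c.
  apply: sq_pos; case: (eqVneq a 0) => [a0|/eqP]; last by left.
  by right=> c0; move: det1; rewrite a0 c0; lia.
have : - (a * (b - a) + c * (d - c)) <= - (a * b + c * d).
  by apply: Smax; exists a, (b - a), c, (d - c); split => //; split => //;
    rewrite -[RHS]det1; ring.
by lia.
Qed.

(** The origin being interior, L has a point with x + y < 0. If it lies outside
    the negative quadrant, it gives with a basis vector one of the excluded
    points or an opposite of a basis vector. In the quadrant it gives the
    opposite of a basis vector off the diagonal, and (-1, -1) on the
    diagonal, where eared_triple applies. *)
Lemma eared_obtuse_basis L : eared L -> L 1 0 -> L 0 1 ->
  ~ L 1 (-1) -> ~ L (-1) 1 -> has_opposite_basis L.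
Proof.
move=> eL L10 L01 LN1 LN2; have L00 := eared_origin eL.
have [x [y [Lxy neg]]] := eared_around eL (g := -1) (h := -1) ltac:(by []).
have [y0|y0] := leP 0 y.
  have [yz|ynz] := eqVneq y 0.
    apply: (eared_opposite_basis (a := 1) (c := 0) (u := 1) (v := 0) eL) => //.
    by apply: (eared_conv eL Lxy L00 L00
      (n1 := 1) (n2 := - x - 1) (n3 := 0)); lia.
  by case: LN2; apply: (eared_conv eL Lxy L01 L00
    (n1 := 1) (n2 := - x - y) (n3 := y - 1)); lia.
have [x0|x0] := ltP 0 x.
  by case: LN1; apply: (eared_conv eL Lxy L10 L00
    (n1 := 1) (n2 := - y - x) (n3 := x - 1)); lia.
have [xy|xy|xy] := ltgtP x y.
- apply: (eared_opposite_basis (a := 1) (c := 0) (u := 1) (v := 0) eL) => //.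
  by apply: (eared_conv eL Lxy L01 L00
    (n1 := 1) (n2 := - y) (n3 := y - x - 1)); lia.
- apply: (eared_opposite_basis (a := 0) (c := 1) (u := 0) (v := 1) eL) => //.
  by apply: (eared_conv eL Lxy L10 L00
    (n1 := 1) (n2 := - x) (n3 := x - y - 1)); lia.
have LN : L (-1) (-1).
  by apply: (eared_conv eL Lxy L00 L00
    (n1 := 1) (n2 := - x - 1) (n3 := 0)); lia.
have [z [Lz LNz]] := eared_triple eL L10 L01 LN.
apply: (eared_opposite_basis (a := z) (c := 1) (u := 0) (v := 1) eL) => //.
by lia.
Qed.

Lemma eared_has_opposite_basis L : eared L -> has_opposite_basis L.
Proof.
move=> eL.
have [a [b [c [d [[det1 La Lb] [LN1 LN2]]]]]] := eared_obtuse_pair eL.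
apply: (has_opposite_basis_change det1).
apply: eared_obtuse_basis; first by apply: eared_change => //; left.
- by move: La; congr L; ring.
- by move: Lb; congr L; ring.
- by move=> LN; apply: LN1; move: LN; congr L; ring.
- by move=> LN; apply: LN2; move: LN; congr L; ring.
Qed.

(** * Ears from boundary neighbours *)

(** Both edges at v leave the origin strictly on their left because L spreads
    around the origin, so that det (v, p) and det (q, v) are positive. Applying
    the functional w, normalized by w(p) = w(q) = w(v) - 1, to the linear
    relation det (p, q) v + det (q, v) p + det (v, p) q = 0 yields
    det (p - v, q - v) w(v) = det (v, p) + det (q, v) > 0,
    and the first factor is nonnegative by convexity, so w(v) is positive. *)
Lemma ear_of_neighbours L (vx vy px py qx qy u0 u1 : int) :
  L 0 0 -> L px py -> L qx qy -> (px, py) <> (vx, vy) -> (qx, qy) <> (vx, vy) ->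
  (forall g h, (g, h) <> (0, 0) -> exists x y, L x y /\ 0 < g * x + h * y) ->
  (forall x y, L x y -> 0 <= (px - vx) * (y - vy) - (py - vy) * (x - vx)) ->
  (forall x y, L x y -> 0 <= (vx - qx) * (y - qy) - (vy - qy) * (x - qx)) ->
  u0 * px + u1 * py = u0 * qx + u1 * qy ->
  `|u0 * px + u1 * py - (u0 * vx + u1 * vy)| = 1 ->
  has_ear L vx vy.
Proof.
move=> L0 Lp Lq pv qv ar leftp leftq upq uv.
have X0 : 0 < vx * py - vy * px.
  rewrite ltNge; apply/negP => X0.
  have [|x [y [Lxy]]] := ar (py - vy) (vx - px).
    by case=> E1 E2; apply: pv; congr (_, _); lia.
  by have := leftp _ _ Lxy; lia.
have Y0 : vx * qy - vy * qx < 0.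
  rewrite ltNge; apply/negP => Y0.
  have [|x [y [Lxy]]] := ar (vy - qy) (qx - vx).
    by case=> E1 E2; apply: qv; congr (_, _); lia.
  by have := leftq _ _ Lxy; lia.
have D0 := leftp _ _ Lq.
(* The sign s orients the functional so that v lies above p and q. *)
have [s [s1 us]] : exists s : int, s * s = 1 /\
    s * (u0 * vx + u1 * vy) = s * (u0 * px + u1 * py) + 1.
  have [le|lt] := leP (u0 * px + u1 * py) (u0 * vx + u1 * vy).
    by exists 1; split => //; lia.
  by exists (-1); split => //; lia.
have upE : s * u0 * px + s * u1 * py = s * u0 * vx + s * u1 * vy - 1 by lia.
have uqE : s * u0 * qx + s * u1 * qy = s * u0 * vx + s * u1 * vy - 1.
  by rewrite -upE -!mulrA -!mulrDr upq.
exists px, py, qx, qy, (s * u0), (s * u1); split => //.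
set D := _ - _ in D0.
set w := (X in 1 <= X).
have : D * w = (vx * py - vy * px) - (vx * qy - vy * qx).
  transitivity ((vx * py - vy * px) * (w - (s * u0 * qx + s * u1 * qy))
    - (vx * qy - vy * qx) * (w - (s * u0 * px + s * u1 * py))).
    by rewrite /D /w; ring.
  by rewrite upE uqE -/w; ring.
by move: D w D0 => D w D0; nia.
Qed.

(** * Compactness of convex hulls of finite sets *)

Section Plane.
Variable R : realType.
Local Notation plane := 'rV[R]_2.

Lemma convex_setP (A : set plane) : @convex_set R plane A <->
  forall x y t, A x -> A y -> 0 <= t <= 1 -> A (t *: x + (1 - t) *: y).
Proof.
split=> [cA x y t Ax Ay /andP[t0 t1]|cA x y t].
  by have := cA x y (Itv01 t0 t1); rewrite !inE; apply.
rewrite !inE => Ax Ay; apply: cA => //.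
by apply/andP; split.
Qed.

Lemma convex_hull_convex (V : set plane) : @convex_set R plane (convex_hull V).
Proof.
apply/convex_setP => x y t Vx Vy t01 C [cC VC].
by move/convex_setP: (cC); apply=> //; [apply: Vx|apply: Vy].
Qed.

(** The convex combinations of two points of this set combine the two points of
    A with weights t (1 - s) and (1 - t) (1 - r), whose sum is w. For w > 0
    normalizing these weights gives a point of A; for w = 0 the combination
    is x itself, and any point of A will do. *)
Lemma cone_convex (A : set plane) (x : plane) : @convex_set R plane A ->
  @convex_set R plane [set p.1 *: x + (1 - p.1) *: p.2 | p in `[0, 1] `*` A].
Proof.
move=> /convex_setP cA; apply/convex_setP.
move=> _ _ t [[s y] [/= s01 Ay] <-] [[r z] [/= r01 Az] <-] t01.
move: s01 r01 t01; rewrite !in_itv /= => /andP[s0 s1] /andP[r0 r1] /andP[t0 t1].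
pose w := t * (1 - s) + (1 - t) * (1 - r).
have w0 : 0 <= w by rewrite /w; nra.
have w1 : w <= 1 by rewrite /w; nra.
have [wz|wn0] := eqVneq w 0.
  exists (1, y); first by split=> //=; rewrite in_itv /= lexx ler01.
  have e1 : t * (1 - s) = 0 by rewrite /w in wz; nra.
  have e2 : (1 - t) * (1 - r) = 0 by rewrite /w in wz; nra.
  have e3 : t * s + (1 - t) * r = 1 by nra.
  by rewrite /= !scalerDr !scalerA e1 e2 subrr !scale0r !addr0 -scalerDl e3.
exists (1 - w, t * (1 - s) / w *: y + (1 - t * (1 - s) / w) *: z).
  split=> /=; first by rewrite in_itv /=; apply/andP; split; lra.
  apply: cA => //; have wpos : 0 < w by rewrite lt_neqAle eq_sym wn0.
  rewrite divr_ge0 ?ler_pdivrMr ?mul1r //=; rewrite /w; nra.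
apply/rowP => i; rewrite !mxE.
by rewrite /= /w in wn0 *; field.
Qed.

Lemma compact_cone (A : set plane) (x : plane) : compact A ->
  compact [set p.1 *: x + (1 - p.1) *: p.2 | p in `[0, 1] `*` A].
Proof.
move=> cA; apply: continuous_compact; last first.
  by apply: compact_setX => //; exact: segment_compact.
apply: continuous_subspaceT => -[s y]; apply: cvgD.
  apply: cvgZr_tmp; exact: cvg_fst.
apply: cvgZ; last exact: cvg_snd.
by apply: cvgB; [exact: cvg_cst|exact: cvg_fst].
Qed.

(** The hull is built by adding the points one at a time: the cone from x over
    a compact convex set is again compact and convex. *)
Lemma convex_hull_compact (V : set plane) : finite_set V ->
  compact (convex_hull V).
Proof.
move=> /finite_seqP[s ->{V}].
suff [C [cptC cC sC Cs]] : exists C : set plane, [/\ compact C,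
    @convex_set R plane C, [set` s] `<=` C & C `<=` convex_hull [set` s]].
  suff -> : convex_hull [set` s] = C by [].
  by apply/seteqP; split => //; exact: smallest_sub.
elim: s => [|x s [C [cptC cC sC Cs]]].
  by exists set0; split => //; exact: compact0.
have Csx : C `<=` convex_hull [set` x :: s].
  apply: (subset_trans Cs).
  apply: smallest_sub; first exact: convex_hull_convex.
  by move=> y /= ys; apply: sub_gen_smallest; rewrite /= inE ys orbT.
have xx : convex_hull [set` x :: s] x.
  by apply: sub_gen_smallest; rewrite /= inE eqxx.
have [[c Cc]|C0] := pselect (C !=set0); last first.
  exists [set x]; split => //; first exact: compact_set1.
  - apply/convex_setP => _ _ t -> -> _; rewrite -scalerDl.
    by rewrite [t + _]addrC subrK scale1r.
  - move=> y /=; rewrite inE => /orP[/eqP //|ys].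
    by case: C0; exists y; apply: sC.
  - by move=> _ ->.
exists [set p.1 *: x + (1 - p.1) *: p.2 | p in `[0, 1] `*` C]; split.
- exact: compact_cone.
- exact: cone_convex.
- move=> y /=; rewrite inE => /orP[/eqP ->|ys].
    exists (1, c); first by split=> //=; rewrite in_itv /= lexx ler01.
    by rewrite /= subrr scale0r addr0 scale1r.
  exists (0, y); first by split=> /=; [rewrite in_itv /= lexx ler01|exact: sC].
  by rewrite /= scale0r add0r subr0 scale1r.
- move=> _ [[t y] [/= t01 Cy] <-].
  move/convex_setP: (@convex_hull_convex [set` x :: s]); apply=> //.
    exact: Csx.
Qed.

Lemma convex_hull_closed (V : set plane) :
  finite_set V -> closed (convex_hull V).
Proof.
move=> fV; apply: compact_closed; first exact: norm_hausdorff.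
exact: convex_hull_compact.
Qed.

(** * Lattice points of a quasi-smooth polygon *)

Definition lattice_pt (x y : int) : plane :=
  \row_j (if j == 0 then x else y)%:~R.

Lemma lattice_pt0E x y : lattice_pt x y 0 0 = x%:~R. Proof. by rewrite mxE. Qed.
Lemma lattice_pt1E x y : lattice_pt x y 0 1 = y%:~R. Proof. by rewrite mxE. Qed.
Definition lattice_ptE := (lattice_pt0E, lattice_pt1E).

Lemma row2P (v w : plane) : v 0 0 = w 0 0 -> v 0 1 = w 0 1 -> v = w.
Proof.
move=> E0 E1; apply/rowP => -[[|[|//]] lt2].
  by rewrite (_ : Ordinal lt2 = 0) //; exact: val_inj.
by rewrite (_ : Ordinal lt2 = 1) //; exact: val_inj.
Qed.

Lemma lattice_pt_inj x y x' y' :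
  lattice_pt x y = lattice_pt x' y' -> (x, y) = (x', y').
Proof.
move=> /rowP E; have := E 0; have := E 1.
by rewrite !lattice_ptE => /intr_inj -> /intr_inj ->.
Qed.

Lemma latticeP (v : plane) : lattice v <-> exists x y, v = lattice_pt x y.
Proof.
split=> [/mxOverP vZ|[x [y ->]]]; last first.
  by apply/mxOverP => i j; rewrite mxE; case: ifP => _; exact: intr_int.
have /intrP[x xE] := vZ 0 0; have /intrP[y yE] := vZ 0 1.
by exists x, y; apply: row2P; rewrite lattice_ptE.
Qed.

Lemma dotE (u : 'rV[int]_2) (v : plane) :
  dot u v = (u 0 0)%:~R * v 0 0 + (u 0 1)%:~R * v 0 1.
Proof.
rewrite /dot !big_ord_recl big_ord0 addr0.
by rewrite (_ : lift ord0 ord0 = 1) //; exact: val_inj.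
Qed.

Definition lin (g h : R) (v : plane) : R := g * v 0 0 + h * v 0 1.

Lemma lin_lattice_pt (g h x y : int) :
  lin g%:~R h%:~R (lattice_pt x y) = (g * x + h * y)%:~R.
Proof. by rewrite /lin !lattice_ptE rmorphD !rmorphM. Qed.

Lemma lin_conv g h t (v w : plane) : lin g h (t *: v + (1 - t) *: w) =
  t * lin g h v + (1 - t) * lin g h w.
Proof. by rewrite /lin !mxE; ring. Qed.

Lemma convex_hull_lin_le (V : set plane) (g h b : R) :
  (forall v, V v -> lin g h v <= b) ->
  forall v, convex_hull V v -> lin g h v <= b.
Proof.
move=> Vb; apply: (smallest_sub (X := [set v | lin g h v <= b])) => //.
apply/convex_setP => x y t /= xb yb /andP[t0 t1]; rewrite lin_conv; nra.
Qed.

(** A unique maximizer on V is a unique maximizer on the hull: adding v to the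
    open half-plane below it keeps it convex. *)
Lemma convex_hull_lin_max (V : set plane) (g h : R) (v : plane) :
  (forall w, V w -> w <> v -> lin g h w < lin g h v) ->
  forall w, convex_hull V w -> w <> v -> lin g h w < lin g h v.
Proof.
move=> Vv; pose C := [set w | w = v \/ lin g h w < lin g h v].
suff sub : convex_hull V `<=` C by move=> w /sub[].
apply: smallest_sub; last first.
  by move=> w Vw; have [->|wv] := pselect (w = v); [left|right; exact: Vv].
apply/convex_setP => x y t.
have vle z : C z -> lin g h z <= lin g h v by case=> [->|/ltW].
move=> /= xv yv /andP[t0 t1].
have xle := vle _ xv; have yle := vle _ yv.
have [->|tn0] := eqVneq t 0; first by rewrite scale0r add0r subr0 scale1r.
have [->|tn1] := eqVneq t 1; first by rewrite scale1r subrr scale0r addr0.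
have {t0 tn0}t0 : 0 < t by rewrite lt_neqAle eq_sym tn0.
have {t1 tn1}t1 : 0 < 1 - t by rewrite subr_gt0 lt_neqAle tn1.
rewrite /C /= lin_conv; case: xv => [->|xv]; last by right; nra.
case: yv => [->|yv]; last by right; nra.
by left; rewrite -scalerDl addrC subrK scale1r.
Qed.

Lemma convR_max (a b c t : R) : a <= c -> b <= c -> 0 < t < 1 ->
  c = (1 - t) * a + t * b -> a = c /\ b = c.
Proof.
move=> ac bc /andP[t0 t1] E.
have [ac'|ac'] := ltP a c; first by exfalso; nra.
have [bc'|bc'] := ltP b c; first by exfalso; nra.
by split; apply/le_anti/andP.
Qed.

(** This is how vertices are found: exposed points are extreme. *)
Lemma lin_max_vertex (P : set plane) (g h : R) (v : plane) : P v ->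
  (forall w, P w -> w <> v -> lin g h w < lin g h v) -> vertex P v.
Proof.
move=> Pv vmax; split=> // x y Px Py t t01 vE.
have vle w : P w -> lin g h w <= lin g h v.
  by move=> Pw; have [->//|/(vmax _ Pw)/ltW] := pselect (w = v).
have [|xv yv] := convR_max (vle _ Px) (vle _ Py) t01.
  by rewrite {1}vE /lin !mxE; ring.
by split; apply: contrapT; [move/(vmax _ Px)|move/(vmax _ Py)];
  rewrite ?xv ?yv ltxx.
Qed.

Lemma interior0_lin_gt0 (P : set plane) (g h : R) : interior P 0 ->
  (g, h) <> (0, 0) -> exists2 v, P v & 0 < lin g h v.
Proof.
move=> /nbhs_ballP[e /= e0 eP] gh0.
pose w : plane := \row_j (if j == 0 then g else h).
pose t := e / (2 * (1 + `|w|)).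
have w0 : 0 <= `|w| by [].
have t0 : 0 < t by rewrite divr_gt0 //; lra.
exists (t *: w).
  apply: eP; rewrite -ball_normE /= sub0r normrN normrZ gtr0_norm //.
  rewrite /t mulrAC ltr_pdivrMr; nra.
have : 0 < g * g + h * h.
  have g2 : 0 <= g * g by rewrite -expr2 sqr_ge0.
  have h2 : 0 <= h * h by rewrite -expr2 sqr_ge0.
  rewrite lt_neqAle eq_sym addr_ge0 // andbT; apply/eqP => E; apply: gh0.
  by congr (_, _); apply/eqP; rewrite -sqrf_eq0 expr2; apply/eqP; lra.
by rewrite /lin !mxE /=; nra.
Qed.

(** Compactness of the hull is needed for the neighbours of a vertex: they are
    known to lie in the closure of P only. *)
Lemma eared_polygon (P : set plane) : lattice_polygon P -> quasi_smooth P ->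
  interior P 0 -> eared (fun x y => P (lattice_pt x y)).
Proof.
move=> [[V [finV Vlat PV]] _] qsP intP.
have cP : forall x y t, P x -> P y -> 0 <= t <= 1 -> P (t *: x + (1 - t) *: y).
  by apply/convex_setP; rewrite PV; exact: convex_hull_convex.
have P0 : P (lattice_pt 0 0).
  rewrite (_ : lattice_pt 0 0 = 0); first exact: interior_subset.
  by apply: row2P; rewrite lattice_ptE mxE.
have VP : V `<=` P by rewrite PV; exact: sub_gen_smallest.
have around g h : (g, h) <> (0, 0) ->
    exists x y, P (lattice_pt x y) /\ 0 < g * x + h * y.
  move=> gh0; apply: contrapT => nex.
  have [|v] := interior0_lin_gt0 (g := g%:~R) (h := h%:~R) intP.
    by case=> /eqP gz /eqP hz; apply: gh0; congr (_, _); apply/eqP;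
      rewrite -(intr_eq0 R).
  rewrite PV ltNge => Pv; apply/negP/negPn.
  apply: convex_hull_lin_le Pv => w Vw.
  have /latticeP[x [y wE]] := Vlat _ Vw.
  rewrite wE lin_lattice_pt lerz0 leNgt; apply/negP => pos.
  by apply: nex; exists x, y; rewrite -wE; split=> //; exact: VP.
split => //.
- move=> x1 y1 x2 y2 x3 y3 n1 n2 n3 x y P1 P2 P3 p1 p2 p3 p Ex Ey.
  have [n12|n12] := eqVneq (n1 + n2) 0.
    have n10 : n1 = 0 by lia.
    have n20 : n2 = 0 by lia.
    move: Ex Ey p; rewrite n10 n20 !mul0r !add0r => Ex Ey n30.
    have /mulfI n3I : n3 != 0 by lia.
    by rewrite (n3I _ _ Ex) (n3I _ _ Ey).
  pose a : R := n1%:~R; pose b : R := n2%:~R; pose c : R := n3%:~R.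
  have a0 : 0 <= a by rewrite /a ler0z.
  have b0 : 0 <= b by rewrite /b ler0z.
  have c0 : 0 <= c by rewrite /c ler0z.
  have ab0 : 0 < a + b by rewrite /a /b -intrD ltr0z; lia.
  have abc0 : 0 < a + b + c by lra.
  have t01 : 0 <= a / (a + b) <= 1.
    by rewrite divr_ge0 ?ler_pdivrMr //; lra.
  have s01 : 0 <= (a + b) / (a + b + c) <= 1.
    by rewrite divr_ge0 ?ler_pdivrMr //; lra.
  have ExR : (a + b + c) * x%:~R = a * x1%:~R + b * x2%:~R + c * x3%:~R.
    by rewrite /a /b /c -!rmorphD -!rmorphM -!rmorphD Ex.
  have EyR : (a + b + c) * y%:~R = a * y1%:~R + b * y2%:~R + c * y3%:~R.
    by rewrite /a /b /c -!rmorphD -!rmorphM -!rmorphD Ey.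
  have := cP _ _ _ (cP _ _ _ P1 P2 t01) P3 s01.
  set z := (X in P X); suff -> : lattice_pt x y = z by [].
  apply: row2P; rewrite !mxE /=.
    apply: (mulfI (lt0r_neq0 abc0)).
    by rewrite ExR; field; rewrite !lt0r_neq0.
  apply: (mulfI (lt0r_neq0 abc0)).
  by rewrite EyR; field; rewrite !lt0r_neq0.
- move=> g h.
  have /finite_seqP[s VE] := finV.
  pose M := \big[Order.max/0]_(v <- s) lin g%:~R h%:~R v.
  exists (Num.ceil M) => x y Pxy.
  rewrite -(ler_int R) -lin_lattice_pt; apply: (le_trans _ (ceil_ge M)).
  rewrite PV in Pxy; apply: convex_hull_lin_le Pxy => v.
  by rewrite VE /= => vs; rewrite /M; exact: le_bigmax_seq.
- move=> vx vy g h Pv vmax.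
  have vert : vertex P (lattice_pt vx vy).
    have Pmax w : P w -> w <> lattice_pt vx vy ->
        lin g%:~R h%:~R w < lin g%:~R h%:~R (lattice_pt vx vy).
      rewrite PV; apply: convex_hull_lin_max => {}w Vw.
      have /latticeP[x [y wE]] := Vlat _ Vw.
      rewrite wE !lin_lattice_pt ltr_int => wv; apply: vmax.
        by rewrite -wE; exact: VP.
      by case=> E1 E2; apply: wv; rewrite E1 E2.
    exact: lin_max_vertex Pmax.
  have [vm [vp [[vmv segm latm leftm] [vvp segp latp leftp]
    [u [b [_ lineE dist]]]]]] := qsP _ vert.
  have clP : closed P by rewrite PV; exact: convex_hull_closed.
  have segl (v w : plane) : segment v w v.
    exists 0; first by rewrite /= in_itv /= lexx ler01.
    by rewrite subr0 scale1r scale0r addr0.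
  have segr (v w : plane) : segment v w w.
    exists 1; first by rewrite /= in_itv /= lexx ler01.
    by rewrite subrr scale1r scale0r add0r.
  have bdP v : boundary P v -> P v by case=> /clP.
  have Pvm : P vm by apply: bdP; apply: segm; exact: segl.
  have Pvp : P vp by apply: bdP; apply: segp; exact: segr.
  have /latticeP[qx [qy vmE]] : lattice vm.
    by have [] : (segment vm (lattice_pt vx vy) `&` lattice (R := R)) vm;
      first by rewrite latm; left.
  have /latticeP[px [py vpE]] : lattice vp.
    by have [] : (segment (lattice_pt vx vy) vp `&` lattice (R := R)) vp;
      first by rewrite latp; right.
  have um : dot u vm = b.
    have : line_through vm vp vm by exists 0 => //; rewrite scale0r addr0.
    by rewrite lineE.
  have up : dot u vp = b.
    have : line_through vm vp vp by exists 1 => //; rewrite scale1r addrC subrK.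
    by rewrite lineE.
  have dotZ x y : dot u (lattice_pt x y : plane) = (u 0 0 * x + u 0 1 * y)%:~R.
    by rewrite dotE -lin_lattice_pt.
  subst vm vp; rewrite !dotZ in um up dist.
  apply: (@ear_of_neighbours _ vx vy px py qx qy (u 0 0) (u 0 1)) => //.
  - by case=> E1 E2; apply: vvp; rewrite E1 E2.
  - by case=> E1 E2; apply: vmv; rewrite E1 E2.
  - move=> x y /leftp; rewrite /det2 !mxE /= -!intrB -!intrM -intrB ler0z; lia.
  - move=> x y /leftm; rewrite /det2 !mxE /= -!intrB -!intrM -intrB ler0z; lia.
  - by apply/eqP; rewrite -(eqr_int R) um up.
  - apply/eqP; rewrite -(eqr_int R) intr_norm intrB up; apply/eqP; exact: dist.
Qed.

Lemma lattice_basis_lattice_pt (a b c d : int) : a * d - b * c = 1 ->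
  lattice_basis (lattice_pt a c) (lattice_pt b d).
Proof.
move=> det1; split;
  [by apply/latticeP; exists a, c|by apply/latticeP; exists b, d|].
move=> z /latticeP[x [y ->]].
have combE m n : lattice_pt a c *~ m + lattice_pt b d *~ n =
    lattice_pt (a * m + b * n) (c * m + d * n).
  have mulzE (w : plane) k i j : (w *~ k) i j = k%:~R * w i j.
    by rewrite -scaler_int mxE.
  by apply: row2P; rewrite mxE !mulzE !lattice_ptE rmorphD !rmorphM /=; ring.
exists (d * x - b * y, a * y - c * x); split => [|[m n]] /=.
  rewrite combE; congr lattice_pt.
    by transitivity ((a * d - b * c) * x); [rewrite det1 mul1r|ring].
  by transitivity ((a * d - b * c) * y); [rewrite det1 mul1r|ring].
rewrite combE => /lattice_pt_inj[-> ->]; congr (_, _).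
  by transitivity ((a * d - b * c) * m); [ring|rewrite det1 mul1r].
by transitivity ((a * d - b * c) * n); [ring|rewrite det1 mul1r].
Qed.

Lemma calE_lattice_pt (P : set plane) (x y : int) :
  P (lattice_pt x y) -> P (lattice_pt (- x) (- y)) -> calE P (lattice_pt x y).
Proof.
move=> Pz PNz; split; first by split => //; apply/latticeP; exists x, y.
exists (lattice_pt (- x) (- y)) => //.
by apply: row2P; rewrite !mxE /= rmorphN opprK.
Qed.

End Plane.

Theorem corollary7p3 (R : realType) (P : set 'rV[R]_2) :
  lattice_polygon P -> quasi_smooth P -> interior P 0 ->
  exists e1 e2 : 'rV[R]_2,
    [/\ calE P e1, calE P e2 & lattice_basis e1 e2].
Proof.
move=> latP qsP intP.
have [a [b [c [d [det1 [Pa PNa] [Pb PNb]]]]]] :=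
  eared_has_opposite_basis (eared_polygon latP qsP intP).
exists (lattice_pt R a c), (lattice_pt R b d); split.
- exact: calE_lattice_pt.
- exact: calE_lattice_pt.
- exact: lattice_basis_lattice_pt.
Qed.
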